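(* Let a static electrogravitational field be given, with metric $ds^2=g_{ij}dx^idx^j-e^{\omega}dt^2$, electric potential $\phi$, matter tensor $M^\mu{}_\nu$, electromagnetic energy tensor $E^\mu{}_\nu$ and proper charge density $\sigma$, satisfying the Einstein–Maxwell equations. Suppose the field is of Weyl-type, i.e. $\omega$ is a function of $\phi$, $\omega=\omega(\phi)$. Then $$M^k{}_k-M^4{}_4+\left[\frac{d^2e^{\omega}}{d\phi^2}-2\right]E^4{}_4=\frac{d\,e^{\frac12\omega}}{d\phi}\,\sigma ,$$ where $k$ is summed over the spatial values $1,2,3$.
   Context: Greek indices run over $1,\dots,4$, Latin indices over $1,2,3$. A static space-time has, in suitable coordinates $(x^i,t)$ with $x^4=t$, metric $ds^2=g_{ij}dx^idx^j-e^{\omega}dt^2$, with the Riemannian spatial metric $g_{ij}$ and $\omega$ depending only on the $x^i$. The total energy-momentum tensor is $T_{\mu\nu}=M_{\mu\nu}+E_{\mu\nu}$ ($M$ the matter tensor, $E$ the electromagnetic energy tensor), and Einstein's equations are $R_{\mu\nu}-\frac12Rg_{\mu\nu}=-\kappa T_{\mu\nu}$, with $\kappa>0$ constant and the sign convention for the Ricci tensor in which $R_{44}=-\frac12e^{\omega}(\triangle\omega+\frac12|d\omega|^2)$. The electromagnetic tensor is $F_{\mu\nu}=\nabla_\mu\phi_\nu-\nabla_\nu\phi_\mu$ with $\phi_\mu=(0,0,0,\phi)$, $\phi=\phi(x^i)$ (pure electric field), and $\frac12\kappa E_{\mu\nu}=F_\mu{}^{\alpha}F_{\nu\alpha}-\frac14F_{\alpha\beta}F^{\alpha\beta}g_{\mu\nu}$;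 thus $\kappa E_{ij}=-2e^{-\omega}\phi_{,i}\phi_{,j}+e^{-\omega}|d\phi|^2g_{ij}$ and $\kappa E_{44}=|d\phi|^2$. Maxwell's equations are $\nabla_\nu F^{\mu\nu}=J^\mu=\frac12\kappa\sigma V^\mu$, with $V^\mu=e^{-\omega/2}\delta^\mu_4$ the 4-velocity and $\sigma$ the proper charge density. Norms, index raising and the Laplacian $\triangle$ of functions of $x^i$ are with respect to $g_{ij}$. Explicitly the equations include $$\triangle\phi=\tfrac12\omega^{,i}\phi_{,i}+\tfrac12\kappa\sigma e^{\frac12\omega},$$ $$-\tfrac12e^{\omega}\left(\triangle\omega+\tfrac12|d\omega|^2\right)=-\tfrac12\kappa(M^k{}_k-M^4{}_4)e^{\omega}-|d\phi|^2,$$ $$R_{ij}=2e^{-\omega}\phi_{,i}\phi_{,j}-\kappa M_{ij}+\left(\tfrac12\kappa M^\alpha{}_\alpha-e^{-\omega}|d\phi|^2\right)g_{ij}.$$ *)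

(* Defs.v *)
From mathcomp Require Import all_boot all_order all_algebra.
From mathcomp Require Import all_classical all_reals all_analysis.

Set Implicit Arguments.
Unset Strict Implicit.
Unset Printing Implicit Defensive.
Import Order.TTheory GRing.Theory Num.Theory.
Import numFieldNormedType.Exports.

Local Open Scope classical_set_scope.
Local Open Scope ring_scope.

(** Tensor calculus in one coordinate chart.  A point is its row of coordinates
    z : 'rV[R]_n; a covariant 2-tensor is a field of matrices z |-> (A_ab). *)

Definition partial (R : realType) (n : nat) (i : 'I_n) (f : 'rV[R]_n -> R)
    : 'rV[R]_n -> R :=
  fun z => 'D_(delta_mx 0 i) f z.

(* Class C^k on U, with U meant to be open. *)
Fixpoint Ck (R : realType) (n k : nat) (U : set 'rV[R]_n)
    (f : 'rV[R]_n -> R) : Prop :=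
  (forall z, U z -> {for z, continuous f}) /\
  match k with
  | 0%N => True
  | k'.+1 => forall i : 'I_n,
      (forall z, U z -> derivable f z (delta_mx 0 i)) /\ Ck k' U (partial i f)
  end.

(* Gamma^a_bc *)
Definition christoffel (R : realType) (n : nat) (g : 'rV[R]_n -> 'M[R]_n)
    (a b c : 'I_n) (z : 'rV[R]_n) : R :=
  2^-1 * \sum_(d < n) invmx (g z) a d *
    (partial b (fun y => g y d c) z + partial c (fun y => g y d b) z
     - partial d (fun y => g y b c) z).

(* R_mn = d_n Gamma^a_ma - d_a Gamma^a_mn
          + Gamma^b_ma Gamma^a_bn - Gamma^b_mn Gamma^a_ba.
   This is the opposite of the more common sign; it is the sign for which
   R_44 = - 1/2 e^omega (Laplacian omega + 1/2 |d omega|^2) for the static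
   metric below, and Einstein's equations read
   R_mn - 1/2 R g_mn = - kappa T_mn. *)
Definition ricci (R : realType) (n : nat) (g : 'rV[R]_n -> 'M[R]_n)
    (z : 'rV[R]_n) : 'M[R]_n :=
  \matrix_(m, l)
    (\sum_(a < n) (partial l (christoffel g a m a) z
                   - partial a (christoffel g a m l) z)
     + \sum_(a < n) \sum_(b < n)
         (christoffel g b m a z * christoffel g a b l z
          - christoffel g b m l z * christoffel g a b a z)).

(* A^a_b = g^ac A_cb *)
Definition mixed (R : realType) (n : nat) (g A : 'rV[R]_n -> 'M[R]_n)
    (z : 'rV[R]_n) : 'M[R]_n := invmx (g z) *m A z.

(* A^ab = g^ac g^bd A_cd *)
Definition contravariant (R : realType) (n : nat) (g A : 'rV[R]_n -> 'M[R]_n)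
    (z : 'rV[R]_n) : 'M[R]_n := invmx (g z) *m A z *m (invmx (g z))^T.

Definition scalar_curvature (R : realType) (n : nat)
    (g : 'rV[R]_n -> 'M[R]_n) (z : 'rV[R]_n) : R := \tr (mixed g (ricci g) z).

(* nabla_a v_b *)
Definition nabla_covector (R : realType) (n : nat) (g : 'rV[R]_n -> 'M[R]_n)
    (v : 'rV[R]_n -> 'rV[R]_n) (a b : 'I_n) (z : 'rV[R]_n) : R :=
  partial a (fun y => v y 0 b) z - \sum_(c < n) christoffel g c a b z * v z 0 c.

(* nabla_c B^ab, where B z a b = B^ab *)
Definition nabla_contravariant (R : realType) (n : nat)
    (g B : 'rV[R]_n -> 'M[R]_n) (c a b : 'I_n) (z : 'rV[R]_n) : R :=
  partial c (fun y => B y a b) z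
  + \sum_(d < n) (christoffel g a c d z * B z d b
                  + christoffel g b c d z * B z a d).

(* F_mn = nabla_m v_n - nabla_n v_m *)
Definition em_tensor (R : realType) (n : nat) (g : 'rV[R]_n -> 'M[R]_n)
    (v : 'rV[R]_n -> 'rV[R]_n) (z : 'rV[R]_n) : 'M[R]_n :=
  \matrix_(m, l) (nabla_covector g v m l z - nabla_covector g v l m z).

(* F_m^a F_la - 1/4 F_ab F^ab g_ml *)
Definition em_stress (R : realType) (n : nat) (g F : 'rV[R]_n -> 'M[R]_n)
    (z : 'rV[R]_n) : 'M[R]_n :=
  F z *m invmx (g z) *m (F z)^T
  - (4^-1 * \sum_(a < n) \sum_(b < n) F z a b * contravariant g F z a b)
    *: g z.

(** Static space-times.  Space-time points are rows (x, t) : 'rV[R]_(3 + 1). *)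

Definition position {R : realType} (z : 'rV[R]_(3 + 1)) : 'rV[R]_3 := lsubmx z.
Definition spatial (i : 'I_3) : 'I_(3 + 1) := lshift 1 i.
Definition time : 'I_(3 + 1) := rshift 3 ord0.

(* ds^2 = g_ij dx^i dx^j - e^omega dt^2 *)
Definition static_metric (R : realType) (g : 'rV[R]_3 -> 'M[R]_3)
    (omega : 'rV[R]_3 -> R) (z : 'rV[R]_(3 + 1)) : 'M[R]_(3 + 1) :=
  block_mx (g (position z)) 0 0 (- expR (omega (position z)))%:M.

(* (0, 0, 0, phi) *)
Definition static_potential (R : realType) (phi : 'rV[R]_3 -> R)
    (z : 'rV[R]_(3 + 1)) : 'rV[R]_(3 + 1) :=
  row_mx 0 (phi (position z))%:M.

(* V^m = e^(- omega / 2) delta^m_4 *)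
Definition static_velocity (R : realType) (omega : 'rV[R]_3 -> R)
    (z : 'rV[R]_(3 + 1)) : 'rV[R]_(3 + 1) :=
  expR (- (omega (position z) / 2)) *: delta_mx 0 time.

Definition riemannian (R : realType) (n : nat) (g : 'M[R]_n) : Prop :=
  g^T = g /\ forall v : 'rV[R]_n, v != 0 -> 0 < (v *m g *m v^T) 0 0.

(* The field lives on U x R, with U an open set of spatial coordinates.  M and
   E are the covariant tensors M_mn and E_mn.  M, E and sigma may formally
   depend on t; the field equations exclude it. *)
Record static_electrogravitational_field (R : realType) (kappa : R)
    (U : set 'rV[R]_3) (g : 'rV[R]_3 -> 'M[R]_3) (omega phi : 'rV[R]_3 -> R)
    (M E : 'rV[R]_(3 + 1) -> 'M[R]_(3 + 1)) (sigma : 'rV[R]_(3 + 1) -> R)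
    : Prop := StaticElectrogravitationalField {
  field_domain : open U;
  field_metric_C2 : forall i j, Ck 2 U (fun x => g x i j);
  field_metric_riemannian : forall x, U x -> riemannian (g x);
  field_omega_C2 : Ck 2 U omega;
  field_phi_C2 : Ck 2 U phi;
  field_energy : forall z, U (position z) ->
    let G := static_metric g omega in
    let F := em_tensor G (static_potential phi) in
    (2^-1 * kappa) *: E z = em_stress G F z;
  field_einstein : forall z, U (position z) ->
    let G := static_metric g omega in
    ricci G z - (2^-1 * scalar_curvature G z) *: G z
      = - kappa *: (M z + E z);
  field_maxwell : forall z, U (position z) ->
    let G := static_metric g omega in
    let F := em_tensor G (static_potential phi) in
    forall m,
      \sum_(l < 3 + 1) nabla_contravariant G (contravariant G F) l m l z
        = 2^-1 * kappa * sigma z * static_velocity omega z 0 m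
}.

(* omega = w(phi), with w twice differentiable on an open set containing the
   values of phi, so that the derivatives with respect to phi make sense. *)
Definition weyl_type (R : realType) (U : set 'rV[R]_3)
    (omega phi : 'rV[R]_3 -> R) (w : R -> R) : Prop :=
  (exists I : set R, [/\ open I, phi @` U `<=` I &
     forall u, I u -> derivable w u 1 /\ derivable (derive1 w) u 1]) /\
  (forall x, U x -> omega x = w (phi x)).

(* Main.v *)
Require Import Defs.
From mathcomp Require Import all_boot all_order all_algebra.
From mathcomp Require Import all_classical all_reals all_analysis.
From mathcomp Require Import ring.
Set Implicit Arguments.
Unset Strict Implicit.
Unset Printing Implicit Defensive.
Import Order.TTheory GRing.Theory Num.Theory.
Import numFieldNormedType.Exports.
Local Open Scope ring_scope.

(** Only the time-time component of Einstein's equations and the time component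
    of Maxwell's equations are needed.  Taking the trace and using that E is
    trace-free, the former gives
      R_44 = - kappa/2 e^omega (M^k_k - M^4_4) - |d phi|^2.
    On the other hand, for the static metric,
      R_44 = - d_i Gamma^i_44 + Gamma^i_44 (d_i omega - Gamma^a_ia),
    with Gamma^i_44 = 1/2 e^omega omega^,i.  When omega = w(phi) this symbol is
    f(phi) F^4i with f = 1/2 e^(2w) w', so the product rule and Maxwell's
    equation d_i F^4i + F^4i Gamma^a_ia = kappa sigma e^(-omega/2) / 2 express
    R_44 through |d phi|^2, w', w'' and sigma.  Comparing the two values gives
    the identity. *)

(** * Directional derivatives: sums, products, inverse matrices, and the chain rule *)

Lemma derivable_bigsum (R : realType) (V : normedModType R) (I : Type)
    (r : seq I) (F : I -> V -> R) (x v : V) :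
  (forall i, derivable (F i) x v) ->
  derivable (fun y => \sum_(i <- r) F i y) x v.
Proof.
move=> dF; elim: r => [|i r IH].
  under eq_fun do rewrite big_nil.
  exact: derivable_cst.
under eq_fun do rewrite big_cons.
exact: derivableD.
Qed.

Lemma derivable_bigprod (R : realType) (V : normedModType R) (I : Type)
    (r : seq I) (F : I -> V -> R) (x v : V) :
  (forall i, derivable (F i) x v) ->
  derivable (fun y => \prod_(i <- r) F i y) x v.
Proof.
move=> dF; elim: r => [|i r IH].
  under eq_fun do rewrite big_nil.
  exact: derivable_cst.
under eq_fun do rewrite big_cons.
exact: derivableM.
Qed.

Lemma derivable_det (R : realType) (V : normedModType R) (n : nat)
    (A : V -> 'M[R]_n) (x v : V) :
  (forall i j, derivable (fun y => A y i j) x v) ->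
  derivable (fun y => \det (A y)) x v.
Proof.
move=> dA; apply: derivable_bigsum => s.
apply: derivableM; first exact: derivable_cst.
by apply: derivable_bigprod => i; apply: dA.
Qed.

(** By Cramer's rule each entry is a cofactor divided by the determinant, hence a rational
    expression in the entries of [A]. Invertibility is assumed on a whole neighbourhood because
    [invmx] returns a singular matrix unchanged, where the formula would fail. *)
Lemma derivable_invmx (R : realType) (V : normedModType R) (n : nat)
    (A : V -> 'M[R]_n) (x v : V) (i j : 'I_n) :
  (\near x, A x \in unitmx) ->
  (forall i j, derivable (fun y => A y i j) x v) ->
  derivable (fun y => invmx (A y) i j) x v.
Proof.
move=> uA dA.
have near_adj : {near x, (fun y => (\det (A y))^-1 * cofactor (A y) j i)
    =1 (fun y => invmx (A y) i j)}.
  by apply: filterS uA => y uy; rewrite /invmx uy !mxE.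
refine (near_eq_derivable near_adj _).
have uAx : \det (A x) != 0.
  by rewrite -unitfE -unitmxE; apply: nbhs_singleton uA.
apply: derivableM; first by apply: derivableV => //; exact: derivable_det.
apply: derivableM; first exact: derivable_cst.
apply: derivable_det => k l; under eq_fun do rewrite !mxE.
exact: dA.
Qed.

(* Only directional derivatives are assumed to exist, so the chain rule is
   reduced to the one-dimensional one on the line through x. *)
Lemma derive_line (R : realType) (V : normedModType R) (f : V -> R) (x v : V) :
  (derivable f x v <-> derivable (fun t : R => f (t *: v + x)) 0 1) /\
  'D_v f x = derive1 (fun t : R => f (t *: v + x)) 0.
Proof.
rewrite derive1E /derivable /derive.
have -> : (fun h : R => h^-1 *: ((f \o shift x) (h *: v) - f x)) =
    (fun h : R => h^-1 *: (((fun t : R => f (t *: v + x)) \o shift (0 : R))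
       (h *: (1 : R)) - f ((0 : R) *: v + x))).
  apply/funext => h /=.
  rewrite addr0 scale0r add0r; congr (_ *: (f (_ *: _ + _) - _)).
  by rewrite /GRing.scale /= mulr1.
by [].
Qed.

Lemma is_derive_comp_real (R : realType) (V : normedModType R) (h : R -> R)
    (f : V -> R) (x v : V) :
  derivable h (f x) 1 -> derivable f x v ->
  is_derive x v (fun y => h (f y)) (derive1 h (f x) * 'D_v f x).
Proof.
have [[df _] ef] := derive_line f x v.
have [[_ dhf] ehf] := derive_line (fun y => h (f y)) x v.
move=> dh /df df0.
have f0 : f (0 *: v + x) = f x by rewrite scale0r add0r.
have dh0 : derivable h (f (0 *: v + x)) 1 by rewrite f0.
apply: DeriveDef.
  (* For functions of one real variable, derivability and differentiability coincide, so the
     composite along the line is differentiable. *)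
  apply: dhf; apply/derivable1_diffP.
  by apply: differentiable_comp; apply/derivable1_diffP.
rewrite ehf (derive1_comp (f := fun t : R => f (t *: v + x)) df0 dh0).
by rewrite f0 ef.
Qed.

Lemma is_derive_expR_comp (R : realType) (V : normedModType R) (f : V -> R)
    (x v : V) :
  derivable f x v ->
  is_derive x v (fun y => expR (f y)) (expR (f x) * 'D_v f x).
Proof.
move=> df; rewrite -[X in X * _](derive_val (is_derive := is_derive_expR (f x))).
by rewrite -derive1E; apply: is_derive_comp_real df; exact: derivable_expR.
Qed.

(** * Invertibility of the spatial metric, and the projection from space-time to space *)

Lemma riemannian_unitmx (R : realType) (n : nat) (g : 'M[R]_n) :
  riemannian g -> g \in unitmx.
Proof.
case=> _ pos; rewrite -row_free_unit -kermx_eq0; apply/eqP/row_matrixP => i.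
(* A row v of the kernel satisfies v g = 0, so v g v^T = 0; positivity then forces v = 0. *)
rewrite row0; apply/eqP; apply: contraT => /pos.
have /sub_kermxP -> : (row i (kermx g) <= kermx g)%MS by exact: row_sub.
by rewrite mul0mx mxE ltxx.
Qed.

Lemma position_line (R : realType) (t : R) (v z : 'rV[R]_(3 + 1)) :
  position (t *: v + z) = t *: position v + position z.
Proof. by rewrite /position linearP. Qed.

Lemma position_delta_spatial (R : realType) (i : 'I_3) :
  position (delta_mx 0 (spatial i)) = delta_mx 0 i :> 'rV[R]_3.
Proof. by apply/rowP => j; rewrite !mxE eqxx /= (inj_eq (@lshift_inj _ _)). Qed.

Lemma position_delta_time (R : realType) :
  position (delta_mx 0 time) = 0 :> 'rV[R]_3.
Proof. by apply/rowP => j; rewrite !mxE eq_lrshift. Qed.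

Lemma near_domain (R : realType) (U : set 'rV[R]_3) (z : 'rV[R]_(3 + 1)) :
  open U -> U (position z) -> \near z, U (position z).
Proof.
move=> oU Uz.
have cp : {for z, continuous (@position R)} by exact: continuous_lsubmx.
exact: cp _ (open_nbhs_nbhs (conj oU Uz)).
Qed.

Lemma partial_cst (R : realType) (n : nat) (i : 'I_n) (k : R) (x : 'rV[R]_n) :
  partial i (fun=> k) x = 0.
Proof. exact: derive_cst. Qed.

(** * Coordinate derivatives of time-independent functions *)

Section StaticFunction.
Variables (R : realType) (U : set 'rV[R]_3) (z : 'rV[R]_(3 + 1)).
Variables (f : 'rV[R]_(3 + 1) -> R) (F : 'rV[R]_3 -> R).
Hypotheses (oU : open U) (Uz : U (position z)).
Hypothesis fF : forall y, U (position y) -> f y = F (position y).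

Lemma near_static : \near z, f z = F (position z).
Proof. by apply: filterS (near_domain oU Uz) => y; exact: fF. Qed.

(** Near [z] the function factors through the projection, and the two difference quotients are then
    the same function of h. The derivatives agree as limits, whether or not these converge. *)
Lemma partial_spatial (i : 'I_3) :
  partial (spatial i) f z = partial i F (position z).
Proof.
rewrite /partial (near_eq_derive _ near_static) /derive.
rewrite (_ : (fun h : R => _) = (fun h => h^-1 *:
  ((F \o shift (position z)) (h *: delta_mx 0 i) - F (position z))))//.
apply/funext => h /=.
by rewrite position_line position_delta_spatial.
Qed.

Lemma partial_time : partial time f z = 0.
Proof.
rewrite /partial (near_eq_derive _ near_static) /derive.
rewrite (_ : (fun h : R => _) = cst 0) ?lim_cst//.
apply/funext => h /=.
by rewrite position_line position_delta_time scaler0 add0r subrr scaler0.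
Qed.

End StaticFunction.

Definition differential (R : realType) (n : nat) (f : 'rV[R]_n -> R)
    (x : 'rV[R]_n) : 'rV[R]_n := \row_j partial j f x.

(** A column, whereas the differential is a row: the product [differential f x *m gradient g f x] is
    then the 1 x 1 matrix with entry |df|^2. *)
Definition gradient (R : realType) (n : nat) (g : 'rV[R]_n -> 'M[R]_n)
    (f : 'rV[R]_n -> R) (x : 'rV[R]_n) : 'cV[R]_n :=
  invmx (g x) *m (differential f x)^T.

Lemma sum_space_time (R : nmodType) (F : 'I_(3 + 1) -> R) :
  \sum_a F a = \sum_(i < 3) F (spatial i) + F time.
Proof. by rewrite big_split_ord big_ord1. Qed.

(** * The static metric: inverse, Christoffel symbols and R_44 *)

Section StaticGeometry.
Variables (R : realType) (U : set 'rV[R]_3) (g : 'rV[R]_3 -> 'M[R]_3).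
Variables (omega : 'rV[R]_3 -> R).
Hypothesis oU : open U.
Hypothesis Ug : forall x, U x -> riemannian (g x).
Hypothesis domega : forall x i, U x -> derivable omega x (delta_mx 0 i).

Let G := static_metric g omega.
Implicit Types (x : 'rV[R]_3) (y z : 'rV[R]_(3 + 1)) (a b c d : 'I_(3 + 1)).

Lemma static_metricEss z i j : G z (spatial i) (spatial j) = g (position z) i j.
Proof. exact: block_mxEul. Qed.

Lemma static_metricEst z i : G z (spatial i) time = 0.
Proof. by rewrite /G /static_metric block_mxEur mxE. Qed.

Lemma static_metricEts z i : G z time (spatial i) = 0.
Proof. by rewrite /G /static_metric block_mxEdl mxE. Qed.

Lemma static_metricEtt z : G z time time = - expR (omega (position z)).
Proof. by rewrite /G /static_metric block_mxEdr mxE. Qed.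

Lemma unitmx_static z : U (position z) -> G z \in unitmx.
Proof.
move=> /Ug/riemannian_unitmx; rewrite !unitmxE /G /static_metric => ug.
rewrite det_ublock unitrM ug det_scalar1 unitrN.
by rewrite unitfE gt_eqF// expR_gt0.
Qed.

Lemma invmx_static z : U (position z) ->
  invmx (G z) = block_mx (invmx (g (position z))) 0 0
                  (- expR (- omega (position z)))%:M.
Proof.
move=> /unitmx_static; rewrite /G /static_metric => uG.
by rewrite invmx_block_diag// invmx_scalar invrN expRN.
Qed.

Lemma invmx_staticEss z i j : U (position z) ->
  invmx (G z) (spatial i) (spatial j) = invmx (g (position z)) i j.
Proof. by move=> Uz; rewrite invmx_static// block_mxEul. Qed.

Lemma invmx_staticEst z i : U (position z) -> invmx (G z) (spatial i) time = 0.
Proof. by move=> Uz; rewrite invmx_static// block_mxEur mxE. Qed.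

Lemma invmx_staticEts z i : U (position z) -> invmx (G z) time (spatial i) = 0.
Proof. by move=> Uz; rewrite invmx_static// block_mxEdl mxE. Qed.

Lemma invmx_staticEtt z : U (position z) ->
  invmx (G z) time time = - expR (- omega (position z)).
Proof. by move=> Uz; rewrite invmx_static// block_mxEdr mxE. Qed.

Lemma partial_static_st d i z : partial d (fun y => G y (spatial i) time) z = 0.
Proof. by under eq_fun do rewrite static_metricEst; rewrite partial_cst. Qed.

Lemma partial_static_ts d i z : partial d (fun y => G y time (spatial i)) z = 0.
Proof. by under eq_fun do rewrite static_metricEts; rewrite partial_cst. Qed.

Lemma partial_time_static b c z : U (position z) ->
  partial time (fun y => G y b c) z = 0.
Proof.
move=> Uz.
case: (split_ordP b) => i ->; case: (split_ordP c) => j ->;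
  rewrite ?[i]ord1 ?[j]ord1 ?partial_static_st ?partial_static_ts//.
- by apply: (@partial_time _ U _ _ (fun x => g x i j)) => // y _; rewrite static_metricEss.
- apply: (@partial_time _ U _ _ (fun x => - expR (omega x))) => // y _.
  exact: static_metricEtt.
Qed.

Lemma partial_spatial_static_tt i z : U (position z) ->
  partial (spatial i) (fun y => G y time time) z
  = - (expR (omega (position z)) * partial i omega (position z)).
Proof.
move=> Uz.
rewrite (@partial_spatial _ U _ _ (fun x => - expR (omega x)))//; last first.
  by move=> y _; rewrite static_metricEtt.
have [dexp eexp] := is_derive_expR_comp (@domega _ i Uz).
by rewrite /partial deriveN// eexp.
Qed.

Lemma static_metric_sym b c z : U (position z) -> G z b c = G z c b.
Proof.
move=> Uz.
case: (split_ordP b) => i ->; case: (split_ordP c) => j ->;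
  rewrite ?[i]ord1 ?[j]ord1//.
- by rewrite !static_metricEss -[in LHS](Ug Uz).1 mxE.
- by rewrite static_metricEst static_metricEts.
- by rewrite static_metricEst static_metricEts.
Qed.

Lemma christoffel_static_sym a b c z : U (position z) ->
  christoffel G a b c z = christoffel G a c b z.
Proof.
move=> Uz; congr (_ * _); apply: eq_bigr => d _.
(* Symmetry of the metric is known over [U] only, so the indices are exchanged under the derivative
   by equality near [z]. *)
have -> : partial d (fun y => G y b c) z = partial d (fun y => G y c b) z.
  have Gsym : {near z, (fun y => G y b c) =1 (fun y => G y c b)}.
    by apply: filterS (near_domain oU Uz) => y; exact: static_metric_sym.
  exact: near_eq_derive _ Gsym.
by rewrite [X in _ * (X - _)]addrC.
Qed.

(** This and the next three lemmas evaluate the symbols that enter R_44. Without space-time cross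
    terms and without time dependence, a symbol with an odd number of time indices vanishes. *)
Lemma christoffel_static_sst i j z : U (position z) ->
  christoffel G (spatial i) (spatial j) time z = 0.
Proof.
move=> Uz; rewrite /christoffel sum_space_time.
rewrite invmx_staticEst// mul0r addr0 big1 ?mulr0// => k _.
rewrite !partial_static_st partial_time_static//.
by rewrite !(add0r,subr0,mulr0).
Qed.

Lemma christoffel_static_tts i z : U (position z) ->
  christoffel G time time (spatial i) z = 2^-1 * partial i omega (position z).
Proof.
move=> Uz; rewrite /christoffel sum_space_time.
rewrite big1 ?add0r => [|k _]; last by rewrite invmx_staticEts// mul0r.
rewrite invmx_staticEtt//.
rewrite !partial_time_static// partial_spatial_static_tt// add0r subr0.
rewrite mulrNN; congr (_ * _).
by rewrite mulrA [expR (- _) * _]mulrC expRxMexpNx_1 mul1r.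
Qed.

Lemma christoffel_static_ttt z : U (position z) ->
  christoffel G time time time z = 0.
Proof.
move=> Uz; rewrite /christoffel sum_space_time.
rewrite big1 ?add0r => [|k _]; last by rewrite invmx_staticEts// mul0r.
by rewrite !partial_time_static// !(subr0,addr0,mulr0).
Qed.

Lemma christoffel_static_stt i z : U (position z) ->
  christoffel G (spatial i) time time z
  = 2^-1 * expR (omega (position z)) * gradient g omega (position z) i 0.
Proof.
move=> Uz; rewrite /christoffel sum_space_time.
rewrite invmx_staticEst// mul0r addr0 -mulrA; congr (_ * _).
rewrite !mxE mulr_sumr; apply: eq_bigr => k _.
rewrite !mxE invmx_staticEss// !partial_time_static// partial_spatial_static_tt//.
by rewrite addr0 sub0r opprK mulrCA.
Qed.

(* The contracted symbols Gamma^a_ia are kept unevaluated: they cancel against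
   those of the divergence of F in divergence_em_static. *)
Lemma ricci_static_tt z : U (position z) ->
  ricci G z time time =
    \sum_(i < 3)
      (- partial (spatial i) (christoffel G (spatial i) time time) z
       + christoffel G (spatial i) time time z
         * (partial i omega (position z)
            - \sum_(a < 3 + 1) christoffel G a (spatial i) a z)).
Proof.
move=> Uz; rewrite mxE.
(* Each Gamma^a_4a is identically zero over [U], for spatial a as well as for a = 4. *)
have dt a : partial time (christoffel G a time a) z = 0.
  have [i ->|i ->] := split_ordP a.
  - rewrite (_ : lshift 1 i = spatial i)//.
    apply: (@partial_time _ U _ _ (fun=> 0)) => // y Uy.
    by rewrite christoffel_static_sym// christoffel_static_sst.
  - rewrite ord1.
    apply: (@partial_time _ U _ _ (fun=> 0)) => // y Uy.
    by rewrite christoffel_static_ttt.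
have dtt : partial time (christoffel G time time time) z = 0 by exact: dt.
rewrite sum_space_time dtt subrr addr0.
rewrite sum_space_time.
(* For a = 4 the two quadratic terms Gamma^b_44 Gamma^4_b4 coincide and cancel. *)
under [X in _ + (_ + X)]eq_bigr => b _ do rewrite subrr.
rewrite [X in _ + (_ + X)]big1// addr0.
under eq_bigr => i _ do rewrite dt sub0r.
under [X in _ + X]eq_bigr => i _.
  rewrite sum_space_time christoffel_static_tts// christoffel_static_ttt// mul0r subr0.
  under eq_bigr => j _ do rewrite christoffel_static_sst// mulr0 sub0r.
  rewrite sumrN.
  over.
rewrite !big_split /=; congr (_ + _).
rewrite sumrN exchange_big -sumrN -big_split; apply: eq_bigr => i _ /=.
(* The value a = 4 contributes d_i omega / 2 to the contraction Gamma^a_ia. Hence the coefficient 1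
   of d_i omega in the statement, against the 1/2 coming from Gamma^4_4i. *)
rewrite sum_space_time (christoffel_static_sym time)// christoffel_static_tts//.
rewrite -mulr_sumr; set s := \sum_(i < 3) _.
by field.
Qed.

(** * The electromagnetic field of a static potential *)

Variable phi : 'rV[R]_3 -> R.

Let F := em_tensor G (static_potential phi).

Lemma em_tensor_static z : U (position z) ->
  F z = block_mx 0 (differential phi (position z))^T (- differential phi (position z)) 0.
Proof.
move=> Uz.
have vt y : static_potential phi y 0 time = phi (position y).
  by rewrite /static_potential row_mxEr mxE.
have vs y i : static_potential phi y 0 (spatial i) = 0.
  by rewrite /static_potential row_mxEl mxE.
have dvt i : partial (spatial i) (fun y => static_potential phi y 0 time) z
    = partial i phi (position z).
  by apply: partial_spatial oU Uz _ _ => y _; rewrite vt.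
have dvs a i : partial a (fun y => static_potential phi y 0 (spatial i)) z = 0.
  by under eq_fun do rewrite vs; rewrite partial_cst.
(* The symbols are symmetric in their lower indices, so they cancel and the covariant curl is the
   ordinary one. *)
have FE a b : F z a b = partial a (fun y => static_potential phi y 0 b) z
    - partial b (fun y => static_potential phi y 0 a) z.
  rewrite mxE /nabla_covector.
  under eq_bigr => c _ do rewrite christoffel_static_sym//.
  by rewrite opprB addrA subrK.
apply/matrixP => a b; rewrite FE.
case: (split_ordP a) => i ->; case: (split_ordP b) => j ->;
  rewrite ?[i]ord1 ?[j]ord1.
- by rewrite block_mxEul !dvs subr0 mxE.
- by rewrite block_mxEur dvt dvs subr0 !mxE.
- by rewrite block_mxEdl dvs dvt sub0r !mxE.
- by rewrite block_mxEdr subrr !mxE.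
Qed.

Lemma contravariant_em_static z : U (position z) ->
  let P := expR (- omega (position z)) *: gradient g phi (position z) in
  contravariant G F z = block_mx 0 (- P) P^T 0.
Proof.
move=> Uz P; rewrite /contravariant em_tensor_static// invmx_static//.
rewrite tr_block_mx !mulmx_block !(trmx0,mul0mx,mulmx0,add0r,addr0).
by rewrite /P /gradient tr_scalar_mx mul_mx_scalar mul_scalar_mx !scaleNr scalerN opprK
  -scalemxAl [(_ *: _)^T]linearZ /= trmx_mul trmxK.
Qed.

(** Here F_4^a F_4a = |d phi|^2, while the two off-diagonal blocks contribute equally to F_ab F^ab =
    -2 e^(-omega) |d phi|^2. With G_44 = -e^omega the second term removes half of the first. *)
Lemma em_stress_static_tt z : U (position z) ->
  em_stress G F z time time
  = 2^-1 * (differential phi (position z) *m gradient g phi (position z)) 0 0.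
Proof.
move=> Uz; set P := gradient g phi (position z); set N := (_ *m P) 0 0.
have entry (A B : 'M[R]_(3 + 1)) k : (A - k *: B) time time
    = A time time - k * B time time by rewrite !mxE.
have FC : \sum_(a < 3 + 1) \sum_(b < 3 + 1) F z a b * contravariant G F z a b
    = - 2 * expR (- omega (position z)) * N.
  rewrite sum_space_time contravariant_em_static// em_tensor_static//.
  under eq_bigr => i _.
    rewrite sum_space_time big1 => [|j _]; last by rewrite block_mxEul mxE mul0r.
    rewrite add0r !block_mxEur [_^T _ _]mxE 2![in X in _ * X]mxE.
    over.
  rewrite sum_space_time block_mxEdr mxE mul0r addr0.
  under [X in _ + X]eq_bigr => i _.
    rewrite !block_mxEdl.
    rewrite [X in X * _]mxE [X in _ * X]mxE [X in _ * X]mxE.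
    over.
  rewrite -big_split /N mxE mulr_sumr; apply: eq_bigr => i _ /=.
  by rewrite -/P; ring.
have FF : (F z *m invmx (G z) *m (F z)^T) time time = N.
  rewrite em_tensor_static// invmx_static// tr_block_mx !mulmx_block.
  rewrite !(trmx0,mul0mx,mulmx0,add0r,addr0) block_mxEdr /N /P /gradient.
  by rewrite linearN /= mulmxN !mulNmx opprK mulmxA.
rewrite /em_stress entry FC FF static_metricEtt.
transitivity (N - 2^-1 * (expR (omega (position z)) * expR (- omega (position z))) * N).
  by field.
by rewrite expRxMexpNx_1; field.
Qed.

(** The trace of the identity is the dimension 4, which cancels the factor 1/4 in front of F_ab
    F^ab. *)
Lemma mxtrace_mixed_em_stress z : U (position z) ->
  \tr (mixed G (em_stress G F) z) = 0.
Proof.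
move=> Uz; rewrite /mixed /em_stress mulmxBr linearB /= -scalemxAr.
rewrite mulVmx ?unitmx_static// linearZ /= mxtrace1.
have -> : \sum_(a < 3 + 1) \sum_(b < 3 + 1) F z a b * contravariant G F z a b
    = \tr (invmx (G z) *m (F z *m invmx (G z) *m (F z)^T)).
  have GT : (invmx (G z))^T = invmx (G z).
    rewrite trmx_inv; congr invmx; apply/matrixP => a b.
    by rewrite mxE static_metric_sym.
  rewrite mulmxA mxtrace_mulC exchange_big; apply: eq_bigr => b _ /=.
  rewrite mxE; apply: eq_bigr => a _.
  by rewrite [_^T b a]mxE /contravariant GT !mulmxA.
by rewrite mulrAC mulVf ?pnatr_eq0// mul1r subrr.
Qed.

(** [X i] is F^4i. Since F^44 = 0, only spatial values of l contribute to d_l F^4l and only spatial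
    values of d to Gamma^l_ld F^4d. *)
Lemma divergence_em_static z : U (position z) ->
  let X i x := expR (- omega x) * gradient g phi x i 0 in
  \sum_(l < 3 + 1) nabla_contravariant G (contravariant G F) l time l z
  = \sum_(i < 3) (partial i (X i) (position z)
      + X i (position z) * \sum_(a < 3 + 1) christoffel G a (spatial i) a z).
Proof.
move=> Uz X.
have Cts y i : U (position y) ->
    contravariant G F y time (spatial i) = X i (position y).
  by move=> Uy; rewrite contravariant_em_static// block_mxEdl 2!mxE.
have Cst y i : U (position y) ->
    contravariant G F y (spatial i) time = - X i (position y).
  by move=> Uy; rewrite contravariant_em_static// block_mxEur 2!mxE.
have Css y i j : U (position y) ->
    contravariant G F y (spatial i) (spatial j) = 0.
  by move=> Uy; rewrite contravariant_em_static// block_mxEul mxE.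
have Ctt y : U (position y) -> contravariant G F y time time = 0.
  by move=> Uy; rewrite contravariant_em_static// block_mxEdr mxE.
rewrite /nabla_contravariant.
under eq_bigr => l _ do rewrite big_split /=.
rewrite !big_split /=.
(* Gamma^4_ld is symmetric and F^dl antisymmetric, so their contraction vanishes. *)
have -> : \sum_(l < 3 + 1) \sum_(d < 3 + 1)
    christoffel G time l d z * contravariant G F z d l = 0.
  rewrite sum_space_time.
  under eq_bigr => i _.
    rewrite sum_space_time big1 => [|j _]; last by rewrite Css// mulr0.
    rewrite add0r Cts// christoffel_static_sym//.
    over.
  rewrite sum_space_time Ctt// mulr0 addr0 -big_split big1// => i _ /=.
  by rewrite Cst// mulrN subrr.
rewrite add0r sum_space_time.
rewrite (@partial_time _ U _ _ (fun=> 0)) ?addr0 => [|//|//|y Uy]; last exact: Ctt.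
congr (_ + _).
  apply: eq_bigr => i _.
  by apply: partial_spatial oU Uz _ _ => y; exact: Cts.
rewrite exchange_big sum_space_time [X in _ + X]big1 ?addr0 => [|a _]; last first.
  by rewrite Ctt// mulr0.
apply: eq_bigr => i _; rewrite mulr_sumr; apply: eq_bigr => a _.
by rewrite Cts// mulrC christoffel_static_sym//.
Qed.
End StaticGeometry.

(** * Derivatives of exponentials of w *)

Lemma is_derive_expR_scale (R : realType) (w : R -> R) (c s : R) :
  derivable w s 1 ->
  is_derive s 1 (fun s => expR (c * w s)) (c * derive1 w s * expR (c * w s)).
Proof.
move=> dw.
have dcw : derivable (fun s => c * w s) s 1 by exact: derivableM.
apply: is_derive_eq (is_derive_expR_comp dcw) _.
by rewrite (@deriveMl _ _ w c s 1 dw) derive1E mulrC.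
Qed.

Lemma derive1n2_expR (R : realType) (I : set R) (w : R -> R) (u : R) :
  open I -> I u ->
  (forall s, I s -> derivable w s 1 /\ derivable (derive1 w) s 1) ->
  derive1n 2 (fun s => expR (w s)) u
  = expR (w u) * (derive1 (derive1 w) u + derive1 w u ^+ 2).
Proof.
move=> oI Iu dw; rewrite derive1nS derive1n1 derive1E.
have dE s : I s ->
    is_derive s 1 (fun s => expR (w s)) (expR (w s) * derive1 w s).
  by case/dw => dws _; rewrite derive1E; exact: is_derive_expR_comp.
(* The formula for the first derivative holds on the open set [I], hence near [u], so it can be
   differentiated once more. *)
have dE1 : {near u, derive1 (fun s => expR (w s))
    =1 (fun s => expR (w s) * derive1 w s)}.
  apply: filterS (open_nbhs_nbhs (conj oI Iu)) => s /dE ds.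
  by rewrite derive1E derive_val.
rewrite (near_eq_derive _ dE1).
have [[dE0 dw2] eE] := (dw _ Iu, dE _ Iu).
have dEu := @ex_derive _ _ _ _ _ _ _ eE.
rewrite (deriveM dEu dw2) derive_val -derive1E /GRing.scale /=.
ring.
Qed.

(** * Consequences of the field equations for R_44 and the energy tensor *)

Section WeylField.
Variables (R : realType) (kappa : R) (U : set 'rV[R]_3).
Variables (g : 'rV[R]_3 -> 'M[R]_3) (omega phi : 'rV[R]_3 -> R).
Variables (M E : 'rV[R]_(3 + 1) -> 'M[R]_(3 + 1)) (sigma : 'rV[R]_(3 + 1) -> R).
Hypothesis kappa0 : kappa != 0.
Hypothesis field :
  static_electrogravitational_field kappa U g omega phi M E sigma.

Let G := static_metric g omega.
Let oU := field_domain field.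
Let Ug := field_metric_riemannian field.
Implicit Types (x : 'rV[R]_3) (z : 'rV[R]_(3 + 1)) (i : 'I_3).

Let domega x i : U x -> derivable omega x (delta_mx 0 i).
Proof. by move=> Ux; have [_ /(_ i)[/(_ _ Ux)]] := field_omega_C2 field. Qed.

Let dphi x i : U x -> derivable phi x (delta_mx 0 i).
Proof. by move=> Ux; have [_ /(_ i)[/(_ _ Ux)]] := field_phi_C2 field. Qed.

Let ddphi x i j : U x -> derivable (partial i phi) x (delta_mx 0 j).
Proof.
move=> Ux; have [_ /(_ i)[_ [_ /(_ j)[d _]]]] := field_phi_C2 field.
exact: d.
Qed.

Let dg x i j k : U x -> derivable (fun x => g x i j) x (delta_mx 0 k).
Proof. by move=> Ux; have [_ /(_ k)[/(_ _ Ux)]] := field_metric_C2 field i j. Qed.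

(** This makes F^4i differentiable, as the product rule for Gamma^i_44 = f(phi) F^4i requires. *)
Lemma derivable_gradient x i k : U x ->
  derivable (fun x => gradient g phi x k 0) x (delta_mx 0 i).
Proof.
move=> Ux.
have -> : (fun x => gradient g phi x k 0)
    = (fun x => \sum_(j < 3) invmx (g x) k j * partial j phi x).
  by apply/funext => y; rewrite mxE; apply: eq_bigr => j _; rewrite !mxE.
apply: derivable_bigsum => j; apply: derivableM; last exact: ddphi.
apply: derivable_invmx => [|l m]; last exact: dg.
apply: filterS (open_nbhs_nbhs (conj oU Ux)) => y Uy.
exact: riemannian_unitmx (Ug Uy).
Qed.

Lemma energy_mixed_trace z : U (position z) -> \tr (mixed G E z) = 0.
Proof.
move=> Uz; have /= eE := field_energy field Uz.
have := mxtrace_mixed_em_stress omega Ug phi Uz.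
rewrite /mixed -eE -scalemxAr linearZ /= => /eqP.
by rewrite mulf_eq0 mulf_eq0 invr_eq0 pnatr_eq0 (negPf kappa0) /= => /eqP.
Qed.

Lemma energy_tt z : U (position z) ->
  kappa * E z time time
  = (differential phi (position z) *m gradient g phi (position z)) 0 0.
Proof.
move=> Uz; have /= eE := field_energy field Uz.
have := em_stress_static_tt omega oU Ug phi Uz.
rewrite -eE mxE -mulrA => /mulfI; apply.
by rewrite invr_eq0 pnatr_eq0.
Qed.

Lemma mixed_static_tt (A : 'rV[R]_(3 + 1) -> 'M[R]_(3 + 1)) z : U (position z) ->
  mixed G A z time time = - expR (- omega (position z)) * A z time time.
Proof.
move=> Uz; rewrite mxE sum_space_time (invmx_staticEtt _ Ug Uz).
by rewrite big1 ?add0r// => i _; rewrite (invmx_staticEts _ Ug _ Uz) mul0r.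
Qed.

Lemma einstein_tt z : U (position z) ->
  ricci G z time time
  = - 2^-1 * kappa * expR (omega (position z))
    * (\sum_(k < 3) mixed G M z (spatial k) (spatial k) - mixed G M z time time)
    - (differential phi (position z) *m gradient g phi (position z)) 0 0.
Proof.
move=> Uz; have /= eR := field_einstein field Uz.
(* Contracting Einstein's equations gives R - 2 R = -kappa M^a_a, because the metric has trace 4 and
   E has trace 0. *)
have : scalar_curvature G z = kappa * \tr (mixed G M z).
  have := congr1 (fun A => \tr (invmx (G z) *m A)) eR.
  rewrite mulmxBr -!scalemxAr mulVmx ?(unitmx_static _ Ug Uz)// mulmxDr.
  rewrite linearB !linearZ linearD /= -/(mixed G M z) -/(mixed G E z).
  rewrite energy_mixed_trace// addr0 mxtrace1 -/(scalar_curvature G z).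
  rewrite -/(mixed G (ricci G) z) -/(scalar_curvature G z) => eS.
  rewrite -[RHS]opprK -mulNr -eS.
  by rewrite -/G /GRing.scale /=; field.
have entry (A B C D : 'M[R]_(3 + 1)) k l : A - k *: B = l *: (C + D) ->
    A time time - k * B time time = l * C time time + l * D time time.
  move=> /(congr1 (fun T : 'M[R]_(3 + 1) => T time time)).
  by rewrite -mulrDr !mxE.
move: (entry _ _ _ _ _ _ eR); rewrite -/G static_metricEtt => eRtt eS.
move: eRtt; rewrite eS.
rewrite /mxtrace sum_space_time.
(* Now M^a_a = [s] + M^4_4 and M_44 = -e^omega M^4_4, so R G_44 / 2 - kappa M_44 equals -kappa/2
   e^omega ([s] - M^4_4). *)
set s := \sum_(k < 3) _; rewrite mixed_static_tt//.
rewrite -energy_tt// => /eqP; rewrite subr_eq => /eqP ->.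
rewrite expRN; have := expR_gt0 (omega (position z)).
by move: (expR _) => e /lt0r_neq0 e0; field.
Qed.

(** * Weyl-type fields: omega = w(phi) *)

Variables (w : R -> R) (I : set R).
Hypothesis oI : open I.
Hypothesis phiI : forall x, U x -> I (phi x).
Hypothesis dw : forall u, I u -> derivable w u 1 /\ derivable (derive1 w) u 1.
Hypothesis omegaE : forall x, U x -> omega x = w (phi x).

Lemma partial_omega x i : U x ->
  partial i omega x = derive1 w (phi x) * partial i phi x.
Proof.
move=> Ux.
have omega_near : {near x, omega =1 (fun x => w (phi x))}.
  by apply: filterS (open_nbhs_nbhs (conj oU Ux)) => y; exact: omegaE.
rewrite /partial (near_eq_derive _ omega_near).
have [dwx _] := dw (phiI Ux).
by have [_ ->] := is_derive_comp_real dwx (@dphi _ i Ux).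
Qed.

Lemma gradient_omega x : U x ->
  gradient g omega x = derive1 w (phi x) *: gradient g phi x.
Proof.
move=> Ux; rewrite /gradient scalemxAr -linearZ; congr (_ *m _^T).
by apply/rowP => i; rewrite !mxE partial_omega.
Qed.

(** The first term is (f w' - f') e^(-w) N, where f' = 1/2 e^(2w) (w'' + 2 w'^2) leaves f w' - f' =
    -1/2 e^(2w) (w'' + w'^2). The second is -f times the Maxwell source. *)
Lemma ricci_weyl_tt z : U (position z) ->
  let u := phi (position z) in
  let N := (differential phi (position z) *m gradient g phi (position z)) 0 0 in
  ricci G z time time
  = - (2^-1 * expR (w u) * N * (derive1 (derive1 w) u + derive1 w u ^+ 2))
    - 4^-1 * kappa * sigma z * derive1 w u * expR (3 / 2 * w u).
Proof.
move=> Uz u N.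
(* [f] is the ratio of Gamma^i_44 = 1/2 e^w w' phi^,i to F^4i = e^(-w) phi^,i, which is [X i]
   below. *)
pose f s := 2^-1 * (expR (2 * w s) * derive1 w s).
pose X i x := expR (- omega x) * gradient g phi x i 0.
have Ux : U (position z) := Uz.
have dX i : derivable (X i) (position z) (delta_mx 0 i).
  apply: derivableM; last exact: derivable_gradient.
  have dNomega : derivable (fun x => - omega x) (position z) (delta_mx 0 i).
    exact: derivableN (@domega _ i Ux).
  exact: (@ex_derive _ _ _ _ _ _ _ (is_derive_expR_comp dNomega)).
have [dwu ddwu] := dw (phiI Ux).
have df : is_derive u 1 f (2^-1 * (expR (2 * w u) *
    (derive1 (derive1 w) u + 2 * derive1 w u ^+ 2))).
  have dA := is_derive_expR_scale 2 dwu.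
  have dB : is_derive u 1 (derive1 w) (derive1 (derive1 w) u).
    by rewrite derive1E; exact: DeriveDef.
  apply: is_derive_eq (is_deriveZ _ (is_deriveM dA dB)) _.
  rewrite /GRing.scale /=; ring.
have chr_tt y i : U (position y) -> christoffel G (spatial i) time time y
    = f (phi (position y)) * X i (position y).
  move=> Uy; rewrite (christoffel_static_stt oU Ug domega _ Uy) gradient_omega// mxE.
  rewrite /f /X omegaE//.
  have -> : expR (w (phi (position y)))
      = expR (2 * w (phi (position y))) * expR (- w (phi (position y))).
    by rewrite -expRD; congr expR; ring.
  by ring.
have dchr i : partial (spatial i) (christoffel G (spatial i) time time) z
    = 'D_1 f u * partial i phi (position z) * X i (position z)
      + f u * partial i (X i) (position z).
  rewrite (@partial_spatial _ U _ _ (fun x => f (phi x) * X i x))//; last first.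
    by move=> y; exact: chr_tt.
  have [cd ce] := is_derive_comp_real (@ex_derive _ _ _ _ _ _ _ df)
    (@dphi _ i Ux).
  rewrite /partial (deriveM cd (dX i)) ce derive1E /GRing.scale /=.
  by rewrite addrC mulrC.
have maxwell : \sum_(i < 3) (partial i (X i) (position z)
      + X i (position z) * \sum_(a < 3 + 1) christoffel G a (spatial i) a z)
    = 2^-1 * kappa * sigma z * expR (- (w u / 2)).
  have V_time : static_velocity omega z 0 time = expR (- (w u / 2)).
    by rewrite /static_velocity !mxE !eqxx mulr1 omegaE.
  rewrite -V_time -(field_maxwell field Uz time).
  by rewrite (divergence_em_static omega oU Ug phi Uz).
have XN : \sum_(i < 3) X i (position z) * partial i phi (position z)
    = expR (- w u) * N.
  rewrite /N mxE mulr_sumr; apply: eq_bigr => i _.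
  rewrite /X omegaE// [differential _ _ _ _]mxE -mulrA.
  by rewrite [gradient _ _ _ _ _ * _]mulrC.
rewrite (ricci_static_tt oU Ug domega Uz).
(* The product rule splits d_i (f X^i); regrouping isolates the divergence that Maxwell's equation
   evaluates. *)
transitivity ((f u * derive1 w u - 'D_1 f u)
    * \sum_(i < 3) X i (position z) * partial i phi (position z)
  - f u * \sum_(i < 3) (partial i (X i) (position z)
      + X i (position z) * \sum_(a < 3 + 1) christoffel G a (spatial i) a z)).
  rewrite !mulr_sumr -sumrB; apply: eq_bigr => i _.
  rewrite dchr chr_tt// partial_omega// -/u; ring.
rewrite maxwell XN derive_val /f.
(* Every exponential is a power of q = e^(w/2), so the claim becomes an identity of rational
   functions. *)
have := expR_gt0 (w u / 2); set q := expR (w u / 2) => /lt0r_neq0 q0.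
have -> : expR (2 * w u) = q ^+ 4 by rewrite -expRM_natl; congr expR; field.
have -> : expR (3 / 2 * w u) = q ^+ 3 by rewrite -expRM_natl; congr expR; field.
have q2 : expR (w u) = q ^+ 2 by rewrite -expRM_natl; congr expR; field.
rewrite !expRN q2 -/q; field.
exact: q0.
Qed.

Lemma weyl_identity z : U (position z) ->
  let u := phi (position z) in
  \sum_(k < 3) mixed G M z (spatial k) (spatial k) - mixed G M z time time
    + (derive1n 2 (fun s : R => expR (w s)) u - 2) * mixed G E z time time
  = derive1 (fun s : R => expR (w s / 2)) u * sigma z.
Proof.
move=> Uz u; have eR := ricci_weyl_tt Uz; rewrite /= in eR.
move: eR; rewrite einstein_tt// -/u.
set S := (\sum_(k < 3) _ - _).
rewrite (mixed_static_tt E)// omegaE// -/u -energy_tt//.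
rewrite (@derive1n2_expR _ I w u oI (phiI Uz) dw).
have [dwu _] := dw (phiI Uz).
have -> : derive1 (fun s : R => expR (w s / 2)) u
    = 2^-1 * derive1 w u * expR (w u / 2).
  have [_ dh] := is_derive_expR_scale 2^-1 dwu.
  have -> : (fun s => expR (w s / 2)) = (fun s => expR (2^-1 * w s)).
    by apply/funext => s; rewrite mulrC.
  by rewrite derive1E dh [2^-1 * w _]mulrC.
have := expR_gt0 (w u / 2); set q := expR (w u / 2) => /lt0r_neq0 q0.
have -> : expR (3 / 2 * w u) = q ^+ 3 by rewrite -expRM_natl; congr expR; field.
have q2 : expR (w u) = q ^+ 2 by rewrite -expRM_natl; congr expR; field.
rewrite !expRN q2 => eS.
(* The factor -kappa/2 e^omega is the coefficient of [S] in R_44; it is nonzero and can be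
   cancelled. *)
apply: (@mulfI _ (- 2^-1 * kappa * q ^+ 2)).
  by rewrite !mulf_neq0// ?expf_neq0// oppr_eq0 invr_eq0 pnatr_eq0.
rewrite mulrDr; move/eqP: eS; rewrite subr_eq => /eqP ->; field.
exact: q0.
Qed.

End WeylField.

Theorem mainTheorem1 (R : realType) (kappa : R) (U : set 'rV[R]_3)
    (g : 'rV[R]_3 -> 'M[R]_3) (omega phi : 'rV[R]_3 -> R)
    (M E : 'rV[R]_(3 + 1) -> 'M[R]_(3 + 1)) (sigma : 'rV[R]_(3 + 1) -> R)
    (w : R -> R) :
  0 < kappa ->
  static_electrogravitational_field kappa U g omega phi M E sigma ->
  weyl_type U omega phi w ->
  forall z : 'rV[R]_(3 + 1), U (position z) ->
    let G := static_metric g omega in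
    let u := phi (position z) in
    \sum_(k < 3) mixed G M z (spatial k) (spatial k) - mixed G M z time time
      + (derive1n 2 (fun s : R => expR (w s)) u - 2) * mixed G E z time time
    = derive1 (fun s : R => expR (w s / 2)) u * sigma z.
Proof.
move=> /lt0r_neq0 kappa0 field [[I [oI phiI dw]] omegaE] z Uz.
apply: (weyl_identity kappa0 field oI _ dw omegaE Uz) => x Ux.
by apply: phiI; exists x.
Qed.
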